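(* Let $z>0$ and let $\gamma_n=\gamma_n(z)$ be the recurrence coefficients of the monic truncated Hermite polynomials $P_n(x;z)$, with $\gamma_0=0$. Then for all $n\ge 1$, $$\gamma_{n}\left(n+\frac{1}{2}-\gamma_{n}-\gamma_{n+1}\right)\left(n-\frac{1}{2}-\gamma_{n}-\gamma_{n-1}\right)=z^{2}\left(\frac{n}{2}-\gamma_{n}\right)^{2}.$$
   Context: For $z>0$ let $L[p]=\int_{-z}^{z}p(x)e^{-x^{2}}dx$, $p\in\mathbb{R}[x]$. The truncated Hermite polynomials $P_n(x;z)$, $n\ge0$, are the monic polynomials in $x$ with $\deg P_n=n$ and $L[P_kP_n]=h_n(z)\delta_{k,n}$, where $h_n(z)=L[P_n^2]>0$. They satisfy the three-term recurrence $xP_n(x;z)=P_{n+1}(x;z)+\gamma_n(z)P_{n-1}(x;z)$ with $P_{-1}=0$, $P_0=1$, where $\gamma_n(z)=h_n(z)/h_{n-1}(z)$ for $n\ge1$; convention: $\gamma_0=0$. *)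

(* Defs.v *)
From HB Require Import structures.
From mathcomp Require Import all_boot all_order all_algebra.
From mathcomp Require Import all_classical all_reals all_analysis.
Set Implicit Arguments.
Unset Strict Implicit.
Unset Printing Implicit Defensive.
Import Order.TTheory GRing.Theory Num.Theory.
Local Open Scope classical_set_scope.
Local Open Scope ring_scope.

Definition truncL (R : realType) (z : R) (p : {poly R}) : R :=
  \int[@lebesgue_measure R]_(x in `[- z, z]) (p.[x] * expR (- x ^+ 2)).

Definition sqnorm (R : realType) (z : R) (P : nat -> {poly R}) (n : nat) : R :=
  truncL z (P n ^+ 2).

Definition truncated_hermite (R : realType) (z : R) (P : nat -> {poly R}) :=
  forall n, [/\ P n \is monic, size (P n) = n.+1 &
    forall k, truncL z (P k * P n) = sqnorm z P n *+ (k == n)].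

(* For n >= 1 this ratio is the coefficient in the three-term recurrence
   'X * P n = P n.+1 + rec_coef z P n *: P n.-1; the value at 0 is a convention. *)
Definition rec_coef (R : realType) (z : R) (P : nat -> {poly R}) (n : nat) : R :=
  if n is m.+1 then sqnorm z P m.+1 / sqnorm z P m else 0.

(* Main.v *)
(* Since x P_n = P_{n+1} + g_n P_{n-1} by parity, applying the integration by
   parts L[p'] = 2 L[x p] + (p(z) - p(-z)) e^{-z^2} to p = x P_n^2 and to
   p = P_{n+1} P_n gives
     (n + 1/2 - g_n - g_{n+1}) h_n = z e^{-z^2} P_n(z)^2,
     ((n+1)/2 - g_{n+1}) h_n = e^{-z^2} P_{n+1}(z) P_n(z).
   The product of the first identity at n and at n+1 is z^2 times the square
   of the second. *)
Require Import Defs.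
From HB Require Import structures.
From mathcomp Require Import all_boot all_order all_algebra.
From mathcomp Require Import all_classical all_reals all_analysis.
From mathcomp Require Import ring.
Set Implicit Arguments.
Unset Strict Implicit.
Unset Printing Implicit Defensive.
Import Order.TTheory GRing.Theory Num.Theory.
Import numFieldNormedType.Exports.
Local Open Scope ring_scope.

(** * The functional [truncL]: linearity, integration by parts, definiteness *)

Section TruncatedGaussianFunctional.
Variable R : realType.
Notation mu := (@lebesgue_measure R).
Implicit Types (p q : {poly R}) (x z : R).

Lemma finite_roots p : p != 0 -> finite_set [set x | root p x].
Proof.
move=> pN0; apply: contrapT => /(infinite_set_fset (size p))[B Bp].
rewrite leqNgt max_poly_roots//; last exact: finmap.fset_uniq.
by apply/allP => x /Bp.
Qed.

Lemma is_derive_horner_gauss p x :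
  is_derive x 1 (fun t => p.[t] * expR (- t ^+ 2))
    ((p^`() - (p * 'X) *+ 2).[x] * expR (- x ^+ 2)).
Proof.
have dp := is_derive_poly p x.
have dg : is_derive x 1 (fun t : R => - t ^+ 2) (- (x *+ 2)).
  apply: (is_derive_eq (is_deriveN (is_deriveX 2 (is_derive_id x 1)))).
  by rewrite /GRing.scale/=; ring.
have de : is_derive x 1 (fun t : R => expR (- t ^+ 2)) (- (x *+ 2) * expR (- x ^+ 2)).
  rewrite mulrC; apply: (is_derive1_comp (is_derive_expR _) dg).
apply: (is_derive_eq (is_deriveM dp de)).
by rewrite /GRing.scale/= hornerD hornerN hornerMn hornerMX; ring.
Qed.

Lemma continuous_horner_gauss p : continuous (fun t : R => p.[t] * expR (- t ^+ 2)).
Proof.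
move=> x; apply/differentiable_continuous/derivable1_diffP.
by have [] := is_derive_horner_gauss p x.
Qed.

Lemma integrable_horner_gauss p z :
  mu.-integrable `[- z, z]%classic
    (EFin \o (fun t : R => p.[t] * expR (- t ^+ 2))).
Proof.
apply: continuous_compact_integrable; first exact: segment_compact.
exact/continuous_subspaceT/continuous_horner_gauss.
Qed.

Lemma truncL_is_zmod_morphism z : zmod_morphism (truncL z).
Proof.
move=> p q; rewrite /truncL -RintegralB//; try exact: integrable_horner_gauss.
by apply: eq_Rintegral => x _; rewrite !hornerE mulrBl.
Qed.

Lemma truncLZ z a p : truncL z (a *: p) = a * truncL z p.
Proof.
rewrite /truncL -RintegralZl//; last exact: integrable_horner_gauss.
by apply: eq_Rintegral => x _; rewrite !hornerZ mulrA.
Qed.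

HB.instance Definition _ z :=
  GRing.isZmodMorphism.Build {poly R} R (truncL z) (truncL_is_zmod_morphism z).
HB.instance Definition _ z :=
  GRing.isScalable.Build R {poly R} R *%R (truncL z) (truncLZ z).

(** The derivative of $p(x)e^{-x^2}$ is $(p'-2xp)e^{-x^2}$, so this is the fundamental theorem of
    calculus on $[-z,z]$; the weight takes the same value at both ends. *)
Lemma truncL_by_parts z p : 0 < z ->
  truncL z p^`() = truncL z (p * 'X) *+ 2 + (p.[z] - p.[- z]) * expR (- z ^+ 2).
Proof.
move=> z0; apply/eqP; rewrite addrC -subr_eq -raddfMn -raddfB; apply/eqP.
rewrite /= /truncL /Rintegral.
rewrite (continuous_FTC2 (F := fun t => p.[t] * expR (- t ^+ 2))).
- by rewrite -EFinB /= sqrrN mulrBl.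
- by rewrite -subr_gt0 opprK addr_gt0.
- exact/continuous_subspaceT/continuous_horner_gauss.
- split.
  + by move=> x _; have [] := is_derive_horner_gauss p x.
  + exact/cvg_at_right_filter/continuous_horner_gauss.
  + exact/cvg_at_left_filter/continuous_horner_gauss.
- move=> x _; rewrite derive1E; by have [] := is_derive_horner_gauss p x.
Qed.

(** A nonnegative integrand with zero integral vanishes almost everywhere. Here it vanishes only at
    roots of [p], a finite set if [p != 0], so $[-z,z]$ would be negligible despite its length
    $2z>0$. *)
Lemma truncL_sqr_eq0 z p : 0 < z -> truncL z (p ^+ 2) = 0 -> p = 0.
Proof.
move=> z0 Lp0; apply/eqP/negP => /negP pN0.
pose D : set (measurableTypeR R) := `[- z, z]%classic.
have mD : measurable D by exact: measurable_itv.
set f := fun t : R => (p ^+ 2).[t] * expR (- t ^+ 2).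
have f0 t : 0 <= f t by rewrite mulr_ge0 ?expR_ge0// hornerE sqr_ge0.
have intf : mu.-integrable D (EFin \o f) by exact: integrable_horner_gauss.
have : (\int[mu]_(t in D) `|(f t)%:E| = 0)%E.
  under eq_integral do rewrite gee0_abs ?lee_fin//.
  rewrite -[LHS]fineK; last first.
    by have := integrable_fin_num mD intf; apply.
  by congr EFin.
move=> /(ae_eq_integral_abs _ mD); case/integrableP: (intf) => mf _ /(_ mf) f_ae0.
have rootsN : mu.-negligible [set t | root p t].
  have croots := finite_set_countable (finite_roots pN0).
  apply/negligibleP; last exact: countable_lebesgue_measure0.
  exact: countable_measurable.
have /measure_negligible : mu.-negligible D.
  apply: negligibleS (negligibleU f_ae0 rootsN) => t tz.
  have [|pt] := boolP (root p t); [by right | left => /(_ tz)/= /eqP].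
  by rewrite eqe mulf_eq0 horner_exp expf_eq0/= -rootE (negPf pt) gt_eqF// expR_gt0.
have z2 : 0 < z - - z by rewrite opprK addr_gt0.
have := lebesgue_measure_itv `[- z, z]; rewrite /= lte_fin -subr_gt0 z2 => muD.
by move=> /(_ mD) /(etrans (esym muD)); rewrite -EFinB => -[] z20; rewrite z20 ltxx in z2.
Qed.

End TruncatedGaussianFunctional.

Lemma size_sub_lead (R : nzRingType) n (p r : {poly R}) :
  (size p <= n.+1)%N -> r \is monic -> size r = n.+1 ->
  (size (p - p`_n *: r)%R <= n)%N.
Proof.
move=> sp /monicP; rewrite lead_coefE => + sr; rewrite sr /= => rn;
apply/leq_sizeP => j; rewrite coefB coefZ.
rewrite leq_eqVlt => /predU1P[<-|nj].
  by rewrite rn mulr1 subrr.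
rewrite [p`_j]nth_default ?(leq_trans sp)// [r`_j]nth_default ?sr//.
by rewrite mulr0 subrr.
Qed.

(** * Parity of the functional *)

Section Symmetry.
Variables (R : realType) (z : R) (z_gt0 : 0 < z).

(* By parts on even powers, whose boundary terms cancel: no change of variable is needed. *)
Lemma truncL_Xodd k : truncL z 'X^(k.*2.+1) = 0.
Proof.
have step i : truncL z 'X^(i.*2.+1) *+ 2 = truncL z 'X^(i.*2.-1) *+ i.*2.
  have := truncL_by_parts ('X^(i.*2) : {poly R}) z_gt0.
  rewrite derivXn raddfMn/= -exprSr => ->.
  by rewrite !hornerXn -mul2n !exprM sqrrN subrr mul0r addr0.
(* Since [(2 == 0)%N] computes to [false], the goal may be doubled by [mulrn_eq0], which puts it in
   the form of [step]. *)
apply/eqP; rewrite -[_ == 0]/((2 == 0)%N || _) -mulrn_eq0 step.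
elim: k => [|k /eqP IHk]; first by rewrite mulr0n.
by rewrite doubleS/= mulrn_eq0/= -[_ == 0]/((2 == 0)%N || _) -mulrn_eq0 step IHk.
Qed.

Lemma truncL_comp_oppX p : truncL z (p \Po - 'X) = truncL z p.
Proof.
rewrite -[p]coefK poly_def !raddf_sum/=; apply: eq_bigr => i _.
rewrite comp_polyZ comp_Xn_poly !truncLZ; congr (_ * _).
rewrite exprNn -signr_odd; case: (boolP (odd i)) => [iodd|_]; last first.
  by rewrite expr0 mul1r.
by rewrite -(odd_double_half i) iodd mulN1r raddfN/= truncL_Xodd oppr0.
Qed.

End Symmetry.

(** * Parity, recurrence and boundary values of the orthogonal polynomials *)

Section Orthogonality.
Variables (R : realType) (z : R) (P : nat -> {poly R}).
Hypotheses (z_gt0 : 0 < z) (hP : truncated_hermite z P).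
Local Notation h := (sqnorm z P).
Local Notation g := (rec_coef z P).
Local Arguments rec_coef : simpl never.

Lemma hermite_monic n : P n \is monic. Proof. by have [] := hP n. Qed.

Lemma size_hermite n : size (P n) = n.+1. Proof. by have [] := hP n. Qed.

Lemma truncL_hermiteM k n : truncL z (P k * P n) = h n *+ (k == n).
Proof. by have [_ _] := hP n. Qed.

Lemma hermite_lead n : (P n)`_n = 1.
Proof. by have /monicP := hermite_monic n; rewrite lead_coefE size_hermite. Qed.

Lemma sqnorm_neq0 n : h n != 0.
Proof.
apply/eqP => /(truncL_sqr_eq0 z_gt0) Pn0.
by have := monic_neq0 (hermite_monic n); rewrite Pn0 eqxx.
Qed.

(** The monic [P j] with [j < m] span the polynomials of size at most [m]: subtract the leading
    multiple of [P m] and descend. *)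
Lemma truncL_mul_eq0 m (d q : {poly R}) :
  (forall j, (j < m)%N -> truncL z (d * P j) = 0) -> (size q <= m)%N ->
  truncL z (d * q) = 0.
Proof.
elim: m q => [|m IHm] q dP sq.
  by move: sq; rewrite leqn0 size_poly_eq0 => /eqP ->; rewrite mulr0 raddf0.
rewrite -(subrK (q`_m *: P m) q) mulrDr raddfD/= -scalerAr truncLZ dP// mulr0 addr0.
apply: IHm => [j jm|]; first exact/dP/ltnW.
exact: size_sub_lead (hermite_monic m) (size_hermite m).
Qed.

(** Such a [d] is orthogonal to itself. This is the uniqueness principle behind both the parity of
    [P n] and the recurrence. *)
Lemma hermite_ortho_eq0 m (d : {poly R}) : (size d <= m)%N ->
  (forall j, (j < m)%N -> truncL z (d * P j) = 0) -> d = 0.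
Proof.
by move=> sd dP; apply: (truncL_sqr_eq0 z_gt0); rewrite expr2; apply: truncL_mul_eq0 sd.
Qed.

(** Modulo lower degree, [q] is a multiple of [P n]; integrals against [P n] thus reduce to reading
    off one coefficient. *)
Lemma truncL_hermite_lead n (q : {poly R}) : (size q <= n.+1)%N ->
  truncL z (P n * q) = q`_n * h n.
Proof.
move=> sq; rewrite -{1}(subrK (q`_n *: P n) q) mulrDr raddfD/= -scalerAr truncLZ.
rewrite truncL_hermiteM eqxx [X in X + _](@truncL_mul_eq0 n) ?add0r// => [j jn|].
  by rewrite truncL_hermiteM gtn_eqF.
exact: size_sub_lead (hermite_monic n) (size_hermite n).
Qed.

Lemma truncL_hermite_lower n (q : {poly R}) : (size q <= n)%N ->
  truncL z (P n * q) = 0.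
Proof. by move=> sq; rewrite truncL_hermite_lead ?(leqW sq)// nth_default ?mul0r. Qed.

(** Both sides have leading coefficient $(-1)^n$ and are orthogonal to lower degrees, so their
    difference is zero. *)
Lemma hermite_parity n : P n \Po - 'X = (-1) ^+ n *: P n.
Proof.
have sNX : size (- 'X : {poly R}) = 2 by rewrite size_polyN size_polyX.
set Q := P n \Po - 'X.
have sQ : size Q = n.+1 by rewrite size_comp_poly2// size_hermite.
have <- : Q`_n = (-1) ^+ n.
  have := lead_coefE Q; rewrite sQ/= => <-.
  rewrite lead_coef_comp ?sNX// size_hermite/= lead_coefN lead_coefX.
  by rewrite (monicP (hermite_monic n)) mul1r.
apply/subr0_eq/(@hermite_ortho_eq0 n) => [|j jn].
  by apply: size_sub_lead (hermite_monic n) (size_hermite n); rewrite sQ.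
rewrite mulrBl raddfB/= -scalerAl truncLZ truncL_hermiteM gtn_eqF// mulr0 subr0.
(* The substitution $x\mapsto -x$ restores [P n] and moves the reflection to [P j], whose degree
   stays below [n]. *)
rewrite -truncL_comp_oppX// comp_polyM -comp_polyA raddfN/= comp_polyX opprK comp_polyXr.
by rewrite truncL_hermite_lower// size_comp_poly2// size_hermite.
Qed.

Lemma horner_hermiteN n x : (P n).[- x] = (-1) ^+ n * (P n).[x].
Proof. by rewrite -hornerZ -hermite_parity horner_comp !hornerE. Qed.

Lemma truncL_hermite_X n : truncL z ('X * P n * P n) = 0.
Proof.
have : truncL z ('X * P n * P n) = - truncL z ('X * P n * P n).
  rewrite -[LHS]truncL_comp_oppX// !comp_polyM comp_polyX hermite_parity.
  rewrite -raddfN/= -!scalerAr -!scalerAl !scalerA -expr2 sqrr_sign scale1r.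
  by rewrite -!mulrA mulNr.
by move/eqP; rewrite eq_sym eqNr => /eqP.
Qed.

Lemma sqnormS n : h n.+1 = g n.+1 * h n.
Proof. by rewrite /rec_coef divfK// sqnorm_neq0. Qed.

(** The difference has degree at most [n] and is orthogonal to each [P j], [j <= n]: by parity for
    [j = n], by the choice of [g n] for [j = n - 1], by degree below that. *)
Lemma hermite_recurrence n : 'X * P n = P n.+1 + g n *: P n.-1.
Proof.
have XPn : ('X * P n)`_n.+1 = 1 by rewrite coefXM hermite_lead.
have sXP j : size ('X * P j) = j.+2.
  by rewrite mulrC size_mulX ?size_hermite// monic_neq0// hermite_monic.
apply/subr0_eq/(@hermite_ortho_eq0 n.+1) => [|j].
  rewrite opprD addrA (leq_trans (size_polyD _ _))// geq_max; apply/andP; split.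
    have := @size_sub_lead _ n.+1 ('X * P n) (P n.+1).
    rewrite XPn scale1r; apply; [by rewrite sXP|exact: hermite_monic|exact: size_hermite].
  rewrite size_polyN (leq_trans (size_scale_leq _ _))// size_hermite.
  by case: (n).
rewrite mulrBl mulrDl raddfB raddfD/= -scalerAl truncLZ !truncL_hermiteM.
rewrite ltnS leq_eqVlt => /predU1P[->|jn].
  rewrite truncL_hermite_X gtn_eqF// add0r mulr0n.
  (* For [n = 0] the index [n.-1] is again [0]; the convention [g 0 = 0] removes the term. *)
  case: (n) => [|m]/=; first by rewrite mul0r addr0 oppr0.
  by rewrite [m == _]ltn_eqF// mulr0 addr0 oppr0.
rewrite [n.+1 == j]gtn_eqF ?leqW// mulr0n add0r.
(* Attaching ['X] to [P j] leaves a polynomial of degree at most [n] to pair with [P n]. *)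
rewrite -mulrA mulrCA truncL_hermite_lead ?sXP// coefXM.
case: n jn {XPn} => // n; rewrite ltnS leq_eqVlt => /predU1P[->|jn]; rewrite succnK.
  by rewrite eqxx hermite_lead mul1r sqnormS subrr.
by rewrite /= nth_default ?size_hermite// [n == j]gtn_eqF// mul0r mulr0n mulr0 subrr.
Qed.

(** In the integration by parts, $L[P_{n+1}'P_n]=(n+1)h_n$, $L[P_{n+1}P_n']=0$ and
    $L[xP_{n+1}P_n]=h_{n+1}$. The product $P_{n+1}P_n$ is odd, so the two boundary terms add up. *)
Lemma hermite_boundary_mul n :
  (n.+1%:R / 2 - g n.+1) * h n = expR (- z ^+ 2) * ((P n.+1).[z] * (P n).[z]).
Proof.
have := truncL_by_parts (P n.+1 * P n) z_gt0.
rewrite derivM raddfD/= [_^`() * _]mulrC.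
have sd m : (size (P m)^`() <= m)%N.
  by rewrite -ltnS -(size_hermite m) lt_size_deriv// monic_neq0// hermite_monic.
rewrite [truncL z (P n * _)]truncL_hermite_lead ?sd// coef_deriv hermite_lead.
rewrite [truncL z (P n.+1 * _^`())]truncL_hermite_lower ?(leq_trans (sd n))// addr0.
rewrite -[P n.+1 * P n * 'X]mulrA [P n * 'X]mulrC truncL_hermite_lead; last first.
  by rewrite mulrC size_mulX ?size_hermite// monic_neq0// hermite_monic.
rewrite coefXM hermite_lead mul1r sqnormS !hornerM !horner_hermiteN => E.
have sgn : (-1) ^+ n.+1 * (-1) ^+ n = -1 :> R by rewrite exprS -mulrA -expr2 sqrr_sign mulr1.
rewrite mulrACA sgn in E.
transitivity ((n.+1%:R * h n - g n.+1 * h n *+ 2) / 2); first by field.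
by rewrite E; field.
Qed.

Lemma truncL_hermite_euler n : truncL z (P n * ('X * (P n)^`())) = n%:R * h n.
Proof.
rewrite truncL_hermite_lead; last first.
  rewrite (leq_trans (size_polyMleq _ _))// size_polyX add2n/=.
  by rewrite -[leqRHS](size_hermite n) lt_size_deriv// monic_neq0// hermite_monic.
by case: n => [|n]; rewrite coefXM/= ?mul0r// coef_deriv hermite_lead.
Qed.

Lemma truncL_sqr_hermiteX n : truncL z ('X * P n * ('X * P n)) = (g n.+1 + g n) * h n.
Proof.
(* At [m = 0] both sides vanish, so no case split on [n] is needed below. *)
have gh m : g m * (g m * h m.-1) = g m * h m.
  by case: m => [|m]; [rewrite !mul0r|rewrite -sqnormS].
rewrite hermite_recurrence mulrDl !mulrDr !raddfD/= -!scalerAl -!scalerAr !truncLZ.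
rewrite !truncL_hermiteM !eqxx [n.+1 == _]gtn_eqF ?ltnS ?leq_pred//.
rewrite [_ == n.+1]ltn_eqF ?ltnS ?leq_pred//.
by rewrite !mulr0n !mulr0 addr0 add0r gh sqnormS mulrDl.
Qed.

(** By parts with the odd polynomial $xP_n^2$, whose derivative is $P_n^2+2xP_nP_n'$; again the
    boundary terms add up. *)
Lemma hermite_boundary_sqr n :
  (n%:R + 1 / 2 - g n - g n.+1) * h n = z * expR (- z ^+ 2) * (P n).[z] ^+ 2.
Proof.
have := truncL_by_parts ('X * (P n * P n)) z_gt0.
have -> : ('X * (P n * P n))^`() = P n * P n + (P n * ('X * (P n)^`())) *+ 2.
  by rewrite !derivM derivX; ring.
have -> : 'X * (P n * P n) * 'X = 'X * P n * ('X * P n) by ring.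
rewrite raddfD raddfMn/= truncL_hermiteM eqxx truncL_hermite_euler truncL_sqr_hermiteX.
rewrite !hornerM !hornerX horner_hermiteN => E.
have sgn : (-1) ^+ n * (-1) ^+ n = 1 :> R by rewrite -expr2 sqrr_sign.
rewrite mulrACA sgn in E.
transitivity ((h n *+ true + n%:R * h n *+ 2 - (g n.+1 + g n) * h n *+ 2) / 2).
  by rewrite mulr1n; field.
by rewrite E; field.
Qed.

End Orthogonality.

Theorem theorem11 (R : realType) (z : R) (hz : 0 < z) (P : nat -> {poly R})
    (hP : truncated_hermite z P) (n : nat) (hn : (1 <= n)%N) :
  let g := rec_coef z P in
  g n * (n%:R + 1 / 2 - g n - g n.+1) * (n%:R - 1 / 2 - g n - g n.-1)
  = z ^+ 2 * (n%:R / 2 - g n) ^+ 2.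
Proof.
case: n hn => // n _ g.
have h0 := sqnorm_neq0 hz hP.
have A := hermite_boundary_sqr hz hP n; have B := hermite_boundary_sqr hz hP n.+1.
have C := hermite_boundary_mul hz hP n; have D := sqnormS hz hP n.
rewrite -/g in A B C D; clearbody g.
(* After multiplication by $h_n^2$, the factor $\gamma_{n+1}$ turns one $h_n$ into $h_{n+1}$, so the
   left side is the product of [B] and [A]; the right side is $z^2$ times the square of [C]. *)
apply: (mulIf (mulf_neq0 (h0 n) (h0 n))).
transitivity (z * expR (- z ^+ 2) * (P n.+1).[z] ^+ 2 *
              (z * expR (- z ^+ 2) * (P n).[z] ^+ 2)).
  by rewrite succnK -A -B D; field.
transitivity (z ^+ 2 * (expR (- z ^+ 2) * ((P n.+1).[z] * (P n).[z])) ^+ 2).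
  by ring.
by rewrite -C; ring.
Qed.
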